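(* Let $k, n, m, s \ge 2$ be integers. Suppose there is an $n$-coloring $G$ of the edges of the complete graph $K_s$ (colors $1,\dots,n$) containing no monochromatic $K_k$ in any color, and suppose there is a set of $m$ vertices of $K_s$ such that the edges among these $m$ vertices receive, under $G$, fewer than $n$ distinct colors. Then $$R_{2n}(k) \ge s^2 + m\bigl(R_n(k-1,\underbrace{k,\dots,k}_{n-1})-1\bigr)+1 .$$
   Context: All colorings are edge-colorings of complete graphs. For integers $n\ge1$ and $k_1,\dots,k_n\ge1$, a $(k_1,\dots,k_n)$-coloring is an assignment of one of $n$ colors $1,\dots,n$ to each edge of a complete graph such that for each $i$ there is no complete subgraph $K_{k_i}$ all of whose edges have color $i$. The Ramsey number $R(k_1,\dots,k_n)$ (also written $R_n(k_1,\dots,k_n)$) is the least $s>0$ such that no $(k_1,\dots,k_n)$-coloring of $K_s$ exists. In the diagonal case $k_1=\dots=k_n=k$ this number is denoted $R_n(k)$. *)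

(* Defs.v *)
From mathcomp Require Import all_boot.

Set Implicit Arguments.
Unset Strict Implicit.
Unset Printing Implicit Defensive.

Definition edges (T : finType) (A : {set T}) : {set {set T}} :=
  [set e : {set T} | e \subset A & #|e| == 2].

(* An edge-coloring of the complete graph on T is a function on all of {set T};
   only its values on two-element sets are ever used. *)
Definition edge_coloring (n : nat) (T : finType) : predArgType :=
  {ffun {set T} -> 'I_n}.

Definition mono (n : nat) (T : finType) (G : edge_coloring n T) (i : 'I_n)
    (A : {set T}) : bool :=
  [forall e in edges A, G e == i].

(* A complete graph on at most one vertex has no edge, hence is monochromatic
   in every color; so if some k_i = 1 then the Ramsey number is 1. *)
Definition ramsey_coloring (n : nat) (ks : 'I_n -> nat) (T : finType)
    (G : edge_coloring n T) : bool :=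
  [forall i : 'I_n, forall A : {set T}, (#|A| == ks i) ==> ~~ mono G i A].

Definition ramsey_colorable (n : nat) (ks : 'I_n -> nat) (s : nat) : bool :=
  [exists G : edge_coloring n 'I_s, ramsey_coloring ks G].

Lemma ramsey_finite (n : nat) (ks : 'I_n -> nat) :
  exists N, forall (T : finType) (G : edge_coloring n T) (X : {set T}),
    N <= #|X| -> exists i, exists A : {set T},
      [/\ A \subset X, #|A| = ks i & mono G i A].
Proof.
have [d] := ubnP (\sum_i ks i); elim: d ks => // d IHd ks ltd.
have [/existsP[i /eqP ks0]|/pred0Pn/= ks_gt0] := boolP [exists i, ks i == 0].
  exists 0 => T G X _; exists i, set0; split; rewrite ?sub0set ?cards0 //.
  apply/forall_inP => e; rewrite inE subset0 => /andP[/eqP-> ].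
  by rewrite cards0.
have {}ks_gt0 i : 0 < ks i.
  by rewrite lt0n; apply/negP => ki0; apply: ks_gt0; exists i.
pose ks' i j := if j == i then (ks j).-1 else ks j.
have /fin_all_exists[N NP] i : exists N, forall (T : finType)
    (G : edge_coloring n T) (X : {set T}), N <= #|X| ->
    exists j, exists A : {set T}, [/\ A \subset X, #|A| = ks' i j & mono G j A].
  apply: IHd; rewrite -ltnS; apply: leq_trans ltd; rewrite ltnS.
  rewrite (bigD1 i) //= [ltnRHS](bigD1 i) //= /ks' eqxx -addSn prednK //.
  by rewrite leq_add2l; apply: leq_sum => j /negbTE->.
exists (\sum_i N i).+1 => T G X leNX.
have /card_gt0P[x xX] : 0 < #|X| by apply: leq_trans leNX.
pose Y i := [set y in X :\ x | G [set x; y] == i].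
have cardY : \sum_i #|Y i| = #|X :\ x|.
  rewrite -sum1_card (partition_big (fun y => G [set x; y]) predT) //=.
  by apply: eq_bigr => i _; rewrite -sum1_card; apply: eq_bigl => y; rewrite inE.
have [i leNY] : exists i, N i <= #|Y i|.
  apply/existsP; apply: contraT => /existsPn ltYN.
  have: \sum_i (#|Y i|).+1 <= \sum_i N i.
    by apply: leq_sum => i _; rewrite ltnNge ltYN.
  have n_gt0 : 0 < n by case: (G set0) => j; apply: leq_trans.
  have := leNX; rewrite (cardsD1 x X) xX add1n ltnS => leNX' ltN.
  have := leq_trans ltN leNX'; rewrite -cardY.
  under eq_bigr => j _ do rewrite -addn1.
  by rewrite big_split /= sum1_card card_ord -[leqRHS]addn0 leq_add2l leqNgt n_gt0.
have [j [A [sAY cardA monoA]]] := NP i T G (Y i) leNY.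
have sAX : A \subset X.
  apply: subset_trans sAY _; apply/subsetP => y.
  by rewrite !inE => /andP[/andP[]].
have [eq_ji|ne_ji] := eqVneq j i; last first.
  by exists j, A; split; rewrite // cardA /ks' (negbTE ne_ji).
have xA : x \notin A.
  by apply/negP => /(subsetP sAY); rewrite !inE eqxx.
exists j, (x |: A); split.
- by rewrite subUset sub1set xX.
- by rewrite cardsU1 xA cardA /ks' eq_ji eqxx add1n prednK.
apply/forall_inP => e; rewrite inE => /andP[se ce].
have [xe|xe] := boolP (x \in e); last first.
  apply: (forall_inP monoA); rewrite inE ce andbT.
  apply/subsetP => y ye; have := subsetP se y ye.
  by rewrite !inE => /orP[/eqP eyx|//]; rewrite -eyx ye in xe.
have /cards1P[y ey] : #|e :\ x| == 1.
  by move: ce; rewrite (cardsD1 x) xe.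
have ye : y \in e :\ x by rewrite ey set11.
have yA : y \in A.
  move: ye; rewrite !inE => /andP[yx /(subsetP se)].
  by rewrite !inE (negbTE yx).
rewrite -(setD1K xe) ey eq_ji.
by have := subsetP sAY y yA; rewrite inE => /andP[].
Qed.

Lemma ramsey_exists (n : nat) (ks : 'I_n -> nat) :
  exists s, (0 < s) && ~~ ramsey_colorable ks s.
Proof.
have [N NP] := ramsey_finite ks; exists N.+1; rewrite ltn0Sn /=.
apply/existsPn => G; apply/negP => /forallP colG.
have [|i [A [_ cA mA]]] := NP _ G setT; first by rewrite cardsT card_ord.
by have /forallP/(_ A) := colG i; rewrite cA eqxx mA.
Qed.

Definition ramsey (n : nat) (ks : 'I_n -> nat) : nat :=
  ex_minn (ramsey_exists ks).

Definition diag_ramsey (n k : nat) : nat := ramsey (fun _ : 'I_n => k).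

(* Main.v *)
Require Import Defs.
From mathcomp Require Import all_boot.

(** Let c be a color missing on M and H a (k-1,k,...,k)-coloring of K_t, with t
    maximal. With two palettes A and B of n colors each, color the pairs (u,v)
    by B_{G(v,v')} inside a row u and by A_{G(u,u')} between rows, except that
    an edge of color A_0 inside a column v of M is recolored B_c. The columns
    of M then contain no A_0, so to each i of M one can attach a copy T_i of H
    in palette A, joined to the column i by A_0 and to everything else
    (the other T_j included) as the vertex i of G in palette B. *)

Set Implicit Arguments.
Unset Strict Implicit.
Unset Printing Implicit Defensive.

Lemma mono_sub (n : nat) (T : finType) (G : edge_coloring n T) (i : 'I_n)
    (A B : {set T}) : A \subset B -> mono G i B -> mono G i A.
Proof.
move=> sAB /forall_inP mB; apply/forall_inP => e; rewrite inE => /andP[seA ce].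
by apply: mB; rewrite inE ce (subset_trans seA sAB).
Qed.

Lemma monoP (n : nat) (T : finType) (G : edge_coloring n T) (i : 'I_n)
    (A : {set T}) :
  reflect {in A &, forall x y, x != y -> G [set x; y] = i} (mono G i A).
Proof.
apply: (iffP forall_inP) => mA.
  move=> x y xA yA nxy; apply/eqP/mA.
  by rewrite inE subUset !sub1set xA yA cards2 nxy.
move=> e; rewrite inE => /andP[seA /cards2P[x [y [nxy def_e]]]].
move: seA; rewrite def_e subUset !sub1set => /andP[xA yA].
by rewrite (mA x y).
Qed.

Lemma exists_subset_card (T : finType) (A : {set T}) (k : nat) :
  k <= #|A| -> exists2 B : {set T}, B \subset A & #|B| = k.
Proof.
rewrite cardE => lek; exists [set:: take k (enum A)].
  by apply/subsetP => x; rewrite inE => /mem_take; rewrite mem_enum.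
rewrite cardsE (card_uniqP _) ?take_uniq ?enum_uniq // size_take_min.
exact/minn_idPl.
Qed.

(** Cliques of the large graph are bounded by projecting them to [G] or [H]. The hypothesis makes
    [phi] injective on [Q], and [ramsey_coloring] forbids exact sizes only, so the image is cut down
    to [ks i] vertices. *)
Lemma ramsey_coloring_clique (n : nat) (ks : 'I_n -> nat) (T V : finType)
    (G : edge_coloring n T) (i : 'I_n) (Q : {set V}) (phi : V -> T) :
  ramsey_coloring ks G ->
  {in Q &, forall x y, x != y ->
    phi x != phi y /\ G [set phi x; phi y] = i} ->
  #|Q| < ks i.
Proof.
move=> /forallP/(_ i)/forallP colG cliqueQ; rewrite ltnNge; apply/negP.
have injphi : {in Q &, injective phi}.
  move=> x y xQ yQ eqphi; apply/eqP; apply: contraT => nxy.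
  by have [] := cliqueQ x y xQ yQ nxy; rewrite eqphi eqxx.
rewrite -(card_in_imset injphi) => /exists_subset_card[B sB cB].
have := colG B; rewrite cB eqxx /= => /negP; apply.
apply: mono_sub sB _; apply/monoP => _ _ /imsetP[x xQ ->] /imsetP[y yQ ->] nxy.
have [|//] := cliqueQ x y xQ yQ.
by apply: contraNneq nxy => ->.
Qed.

(** Allows the construction to be a symmetric function on any vertex and color types. If [V] had at
    least r vertices, r being the Ramsey number, restricting [f] to r of them would color K_r. *)
Lemma card_lt_diag_ramsey (n k : nat) (V C : finType) (f : V -> V -> C) :
  #|C| = n -> (forall x y, f x y = f y x) ->
  (forall (Q : {set V}) (c : C),
     {in Q &, forall x y, x != y -> f x y = c} -> #|Q| < k) ->
  #|V| < diag_ramsey n k.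
Proof.
move=> cardC symf cliquef; rewrite /diag_ramsey /ramsey.
case: ex_minnP => r /andP[r_gt0 /negP ncol] _; rewrite ltnNge.
apply/negP => lerV; apply: ncol.
pose g (x : 'I_r) : V := enum_val (widen_ord lerV x).
have injg : injective g.
  by move=> x y /enum_val_inj/(congr1 val)/= /val_inj.
pose x0 : 'I_r := Ordinal r_gt0.
(* Orders the endpoints of an edge arbitrarily; [symf] makes the choice harmless. The default serves
   only sets that are not of the form {a, b}. *)
pose h (e : {set 'I_r}) : 'I_r * 'I_r :=
  odflt (x0, x0) [pick p | e == [set p.1; p.2]].
pose code (c : C) : 'I_n := cast_ord cardC (enum_rank c).
pose decode (i : 'I_n) : C := enum_val (cast_ord (esym cardC) i).
have codeK : cancel code decode.
  by move=> c; rewrite /code /decode cast_ordK enum_rankK.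
pose F : edge_coloring n 'I_r := [ffun e => code (f (g (h e).1) (g (h e).2))].
have FE x y : F [set x; y] = code (f (g x) (g y)).
  rewrite ffunE /h; case: pickP => [[a b]/= /eqP exy|/(_ (x, y))]; last first.
    by rewrite eqxx.
  have /set2P[eax|eay] : a \in [set x; y] by rewrite exy set21.
    have /set2P[eya|eyb] : y \in [set a; b] by rewrite -exy set22.
      have /set2P[ebx|eby] : b \in [set x; y] by rewrite exy set22.
        by rewrite eya eax ebx.
      by rewrite eby eax.
    by rewrite eax eyb.
  have /set2P[exa|exb] : x \in [set a; b] by rewrite -exy set21.
    have /set2P[ebx|eby] : b \in [set x; y] by rewrite exy set22.
      by rewrite symf eay ebx.
    by rewrite exa eby eay.
  by rewrite symf eay exb.
apply/existsP; exists F; apply/forallP => i; apply/forallP => A.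
apply/implyP => /eqP cA; apply/negP => /monoP mA.
have := cliquef (g @: A) (decode i); rewrite card_imset // cA ltnn.
move=> noclique; suff: false by []; apply: noclique.
move=> _ _ /imsetP[x xA ->] /imsetP[y yA ->] nxy.
rewrite -(mA x y) // ?FE ?codeK //.
by apply: contraNneq nxy => ->.
Qed.

Lemma ramsey_pred_coloring (n : nat) (ks : 'I_n -> nat) :
  0 < n -> (forall i, 0 < ks i) ->
  exists H : edge_coloring n 'I_(ramsey ks - 1), ramsey_coloring ks H.
Proof.
move=> n_gt0 ks_gt0; rewrite /ramsey; case: ex_minnP => r /andP[r_gt0 _] minr.
have [r_gt1|r_le1] := ltnP 1 r.
  apply/existsP; apply: contraT => ncol; have := minr (r - 1).
  rewrite subn_gt0 r_gt1 /ramsey_colorable ncol leqNgt ltn_subrL r_gt0.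
  by move=> /(_ isT).
(* Minimality ranges over positive sizes and says nothing about r - 1 = 0, but on no vertices any
   coloring will do. *)
have -> : r - 1 = 0 by apply/eqP; rewrite subn_eq0.
exists [ffun=> Ordinal n_gt0]; apply/forallP => i; apply/forallP => A.
have := max_card A; rewrite card_ord leqn0 => /eqP->.
by rewrite eq_sym -[_ == 0]negbK -lt0n ks_gt0.
Qed.

Lemma card_vertices (s t : nat) (M : {set 'I_s}) :
  #|{: 'I_s * 'I_s + {i | i \in M} * 'I_t}| = s ^ 2 + #|M| * t.
Proof. by rewrite card_sum !card_prod card_sig !card_ord mulnn. Qed.

Section Construction.

Variables (n s t : nat) (G : edge_coloring n 'I_s) (H : edge_coloring n 'I_t).
Variables (M : {set 'I_s}) (z c0 : 'I_n).

Definition vertex : finType := ('I_s * 'I_s + {i | i \in M} * 'I_t)%type.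

(* [inl] is the palette A and [inr] the palette B of the header; [z] is the
   color 0 and [c0] the color c missing on M. *)
Definition color (x y : vertex) : 'I_n + 'I_n :=
  match x, y with
  | inl (u, v), inl (u', v') =>
      if u == u' then inr (G [set v; v'])
      else if [&& v == v', v \in M & G [set u; u'] == z] then inr c0
      else inl (G [set u; u'])
  | inl (u, v), inr (i, a) | inr (i, a), inl (u, v) =>
      if v == val i then inl z else inr (G [set v; val i])
  | inr (i, a), inr (j, b) =>
      if i == j then inl (H [set a; b]) else inr (G [set val i; val j])
  end.

Lemma color_sym x y : color x y = color y x.
Proof.
case: x y => [[u v]|[i a]] [[u' v']|[j b]] //=.
- rewrite [u' == u]eq_sym [v' == v]eq_sym.
  rewrite ![[set u'; _]]setUC ![[set v'; _]]setUC.
  by case: (eqVneq v v') => // ->.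
- rewrite [j == i]eq_sym ![[set val j; _]]setUC.
  by rewrite [[set b; _]]setUC.
Qed.

Variable k : nat.
Hypotheses (colG : ramsey_coloring (fun=> k) G)
  (colH : ramsey_coloring (fun i => if i == z then k - 1 else k) H)
  (k_gt1 : 1 < k)
  (missM : {in M &, forall i j, i != j -> G [set i; j] != c0}).

Definition is_old (x : vertex) : bool := if x is inl _ then true else false.

(** A vertex of a copy T_i has no row; [u0] is a dummy value. *)
Definition row (u0 : 'I_s) (x : vertex) : 'I_s :=
  if x is inl (u, _) then u else u0.

Definition column (x : vertex) : 'I_s :=
  match x with inl (_, v) => v | inr (i, _) => val i end.

(** Between old vertices, palette A only joins distinct rows and copies [G] there, so [row] projects
    [Q] to a clique of [G]. *)
Lemma old_clique_A (Q : {set vertex}) (d : 'I_n) :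
  {in Q, forall x, is_old x} ->
  {in Q &, forall x y, x != y -> color x y = inl d} -> #|Q| < k.
Proof.
move=> oldQ cQ; have [->|[x0 _]] := set_0Vmem Q; first by rewrite cards0 ltnW.
apply: (ramsey_coloring_clique (i := d) (phi := row (column x0)) colG).
move=> x y xQ yQ nxy; have := cQ x y xQ yQ nxy; move: (oldQ x xQ) (oldQ y yQ).
case: x {xQ nxy} => [[u v]|//] _; case: y {yQ} => [[u' v']|//] _ /=.
by case: eqVneq => // nu; case: ifP => // _ [->].
Qed.

(** Palette A never joins two different copies T_i, so [Q] lies in one copy of [H]. *)
Lemma new_clique_A (Q : {set vertex}) (d : 'I_n) :
  {in Q &, forall x y, x != y -> color x y = inl d} ->
  {in Q, forall x, ~~ is_old x} ->
  #|Q| < if d == z then k - 1 else k.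
Proof.
move=> cQ newQ; have [->|[[p|[i0 a0]] x0Q]] := set_0Vmem Q.
- by rewrite cards0; case: ifP => _; rewrite ?subn_gt0 // ltnW.
- by have := newQ _ x0Q.
pose phi (x : vertex) : 'I_t := if x is inr (_, a) then a else a0.
apply: (ramsey_coloring_clique (i := d) (phi := phi) colH) => x y xQ yQ nxy.
have := cQ x y xQ yQ nxy; move: (newQ x xQ) (newQ y yQ) nxy.
case: x {xQ} => [//|[i a]] _; case: y {yQ} => [//|[j b]] _ /=.
case: (eqVneq i j) => // -> nab [->]; split=> //.
by apply: contraNneq nab => ->.
Qed.

(** If [Q] has both old and new vertices, its color is [z] and its old part lies in a column of [M].
    The recoloring leaves no such edge there, so there is at most one old vertex, added to at most k
    - 2 new ones. *)
Lemma clique_A (Q : {set vertex}) (d : 'I_n) :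
  {in Q &, forall x y, x != y -> color x y = inl d} -> #|Q| < k.
Proof.
move=> cQ; pose O := [set x | is_old x].
have cQnew : #|Q :\: O| < if d == z then k - 1 else k.
  apply: new_clique_A => [x y /setDP[xQ _] /setDP[yQ _]|x /setDP[_]].
    exact: cQ.
  by rewrite inE.
have [new0|[x0 /setDP[]]] := set_0Vmem (Q :\: O).
  apply: (old_clique_A _ cQ) => x xQ; apply: contraT => new_x.
  by have := in_set0 x; rewrite -new0 !inE new_x xQ.
case: x0 => [p|[i a]] x0Q; rewrite inE //= => _; rewrite -(cardsID O Q).
have old_col u v : inl (u, v) \in Q -> v = val i /\ d = z.
  move=> uvQ; have := cQ _ _ uvQ x0Q isT.
  by rewrite /=; case: eqVneq => // -> [->].
have [eq_dz|ne_dz] := eqVneq d z; last first.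
  rewrite (_ : Q :&: O = set0) ?cards0.
    by rewrite (negbTE ne_dz) in cQnew.
  apply/setP => -[[u v]|p]; rewrite !inE ?andbF // andbT.
  by apply/negP => /old_col[_ /eqP]; rewrite (negbTE ne_dz).
rewrite eq_dz eqxx ltn_subRL in cQnew; apply: leq_ltn_trans cQnew.
rewrite leq_add2r; apply/card_le1_eqP => x y.
case: x => [[u v]|p]; rewrite !inE ?andbF // andbT => uvQ.
case: y => [[u' v']|p]; rewrite ?andbF // andbT => uvQ'.
have [ev _] := old_col _ _ uvQ; have [ev' _] := old_col _ _ uvQ'.
apply/eqP; apply: contraT => nxy; have := cQ _ _ uvQ' uvQ nxy.
rewrite /= ev ev' eqxx (valP i) /=; case: eqVneq => // _.
by case: eqVneq => // nGz [eGd]; rewrite eGd eq_dz eqxx in nGz.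
Qed.

(** Without recolored edges, [column] maps [Q] to a clique of color [d] in [G]. With one, [Q] lies
    in a single column, and [row] maps it to a clique of [G] in the color [z] that was
    overwritten. *)
Lemma clique_B (Q : {set vertex}) (d : 'I_n) :
  {in Q &, forall x y, x != y -> color x y = inr d} -> #|Q| < k.
Proof.
move=> cQ.
pose bad := [exists p : ('I_s * 'I_s) * 'I_s,
  [&& inl (p.1.1, p.2) \in Q, inl (p.1.2, p.2) \in Q & p.1.1 != p.1.2]].
(* A recolored edge in Q confines Q to its column: palette B meets two rows only
   inside a column of M, and c missing on M keeps the copies T_i out. *)
have [/existsP[[[u u'] v] /= /and3P[uQ u'Q nu]]|/existsPn good] := boolP bad.
  have nuv : inl (u, v) != inl (u', v) :> vertex.
    by apply: contraNneq nu => -[->].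
  have := cQ _ _ uQ u'Q nuv.
  rewrite /= (negbTE nu) eqxx /=; case: ifP => // /andP[vM _] [def_d].
  have colQ x : x \in Q -> x = inl (row u x, v).
    case: x => [[w v']|[i a]] xQ; last first.
      have := cQ _ _ uQ xQ isT; rewrite /=; case: eqVneq => // nvi [eGd].
      by have := missM vM (valP i) nvi; rewrite eGd def_d eqxx.
    apply/eqP; apply: contraT => /= nv.
    have {nv} nv : v' != v by apply: contraNneq nv => ->.
    (* One of [u], [u'] differs from [w]; the edge to it would change both row and column, hence be
       in palette A. *)
    have [w0 w0Q nw] : exists2 w0, inl (w0, v) \in Q & w != w0.
      have [ewu|nwu] := eqVneq w u; last by exists u.
      by exists u'; rewrite // ewu.
    have nx : inl (w, v') != inl (w0, v) :> vertex.
      by apply: contraNneq nv => -[_ ->].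
    by have := cQ _ _ xQ w0Q nx; rewrite /= (negbTE nw) (negbTE nv).
  apply: (ramsey_coloring_clique (i := z) (phi := row u) colG) => x y xQ yQ nxy.
  have := cQ x y xQ yQ nxy; rewrite (colQ x xQ) (colQ y yQ) /= eqxx vM /=.
  case: eqVneq => [eqr|_]; last by case: eqVneq.
  by rewrite (colQ x xQ) (colQ y yQ) eqr eqxx in nxy.
apply: (ramsey_coloring_clique (i := d) (phi := column) colG) => x y xQ yQ nxy.
have := cQ x y xQ yQ nxy.
case: x y xQ yQ nxy => [[u v]|[i a]] [[u' v']|[j b]] xQ yQ nxy /=.
- have [eu|nu] := eqVneq u u'.
    by move=> [->]; split=> //; apply: contraNneq nxy => ->; rewrite eu.
  have [ev|nv] := eqVneq v v'; last by [].
  by have := good (u, u', v); rewrite /= xQ nu ev yQ.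
- by case: eqVneq => // nv [->].
- by case: eqVneq => // nv [<-]; rewrite setUC.
- by case: eqVneq => // ni [->].
Qed.

End Construction.

Theorem theorem2 (k n m s : nat)
    (hk : 2 <= k) (hn : 2 <= n) (hm : 2 <= m) (hs : 2 <= s)
    (G : edge_coloring n 'I_s) (hG : ramsey_coloring (fun _ : 'I_n => k) G)
    (M : {set 'I_s}) (hM : #|M| = m) (hcol : #|G @: edges M| < n) :
  s ^ 2 + m * (ramsey (fun i : 'I_n => if i == 0 :> nat then k - 1 else k) - 1)
    + 1 <= diag_ramsey (2 * n) k.
Proof.
have [c0 c0M] : exists c0, c0 \notin G @: edges M.
  apply/existsP; apply: contraLR hcol => /existsPn allM.
  rewrite -leqNgt -[leqLHS]card_ord -cardsT subset_leq_card //.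
  by apply/subsetP => c _; have := allM c; rewrite negbK.
have missM : {in M &, forall i j, i != j -> G [set i; j] != c0}.
  move=> i j iM jM nij; apply: contraNneq c0M => <-; apply: imset_f.
  by rewrite inE subUset !sub1set iM jM cards2 nij.
set ks := fun i : 'I_n => _.
have ks_gt0 i : 0 < ks i.
  by rewrite /ks; case: ifP => _; rewrite ?subn_gt0 // ltnW.
have [H colH] := ramsey_pred_coloring (ltnW hn) ks_gt0.
rewrite addn1 -hM -card_vertices.
(* Here [z] is the color 0, the one whose entry in [ks] is [k - 1]. *)
apply: (@card_lt_diag_ramsey _ _ _ _ (color G H (Ordinal (ltnW hn)) c0)).
- by rewrite card_sum card_ord addnn mul2n.
- exact: color_sym.
- move=> Q [d|d]; first exact: clique_A.
  exact: clique_B.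
Qed.
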